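(* Let $V$ and $G$ be two distributions supported on $[0,\infty)$ such that $G\in\mathcal L(\gamma)\cap\mathcal{OS}$ for some $0\le\gamma<\infty$, $M(G,\gamma)<\infty$ and $\overline V(x)=O(\overline G(x))$. Put $$A_1=\sup_{x\ge0}\frac{\overline V(x)}{\overline G(x)},\qquad a=M(V,\gamma)+A_1\big(C^*(G)-2M(G,\gamma)\big).$$ Then for any constant $M$ satisfying $a<M<1+a$ and any constant $\varepsilon>0$ satisfying $$(1+\varepsilon)\big(a+(2+A_1)\varepsilon\big)<M,$$ there exists a constant $K=K(V,G,\gamma,\varepsilon)>0$ such that, for all integers $k\ge1$ and all $x\ge0$, $$\overline{V^{*k}}(x)\le K M^k\,\overline G(x).$$
   Context: All limits are as $x\to\infty$. $\overline V=1-V$; $V^{*k}$ is the $k$-fold convolution of $V$ with itself. $M(V,\gamma)=\int_{[0,\infty)}e^{\gamma y}V(dy)$. $C^*(G)=\limsup\overline{G^{*2}}(x)/\overline G(x)$, and $G\in\mathcal{OS}$ means $C^*(G)<\infty$. For $\gamma\ge0$, $G\in\mathcal L(\gamma)$ if $\overline G(x)>0$ for all $x$ and $\overline G(x-t)/\overline G(x)\to e^{\gamma t}$ for every fixed $t>0$ (if $\gamma>0$ and $G$ is lattice, $x$ and $t$ are restricted to multiples of the lattice span). *)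

(* Defs.v *)
From HB Require Import structures.
From mathcomp Require Import all_boot all_order all_algebra.
From mathcomp Require Import all_classical all_reals all_analysis.
From mathcomp Require Import measurable_realfun.

Set Implicit Arguments.
Unset Strict Implicit.
Unset Printing Implicit Defensive.
Import Order.TTheory GRing.Theory Num.Theory.
Import numFieldNormedType.Exports.

Local Open Scope classical_set_scope.
Local Open Scope ring_scope.

(* Lets the library's bigO notation be used at +oo. *)
Canonical pinfty_filter_on (R : realType) : filter_on R :=
  FilterType (pinfty_nbhs R) _.

Notation distr R := (probability (measurableTypeR R) R).

Section Distributions.
Context {R : realType}.
Implicit Types (V W G : distr R) (gamma x t d : R).

Definition supported_nonneg V := V [set x | 0 <= x] = 1%E.

Definition tail V x : R := fine (V [set y | x < y]).

Definition sum_pair (z : measurableTypeR R * measurableTypeR R) :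
  measurableTypeR R := z.1 + z.2.

Lemma measurable_sum_pair : measurable_fun setT sum_pair.
Proof. exact: measurable_funD. Qed.

HB.instance Definition _ :=
  isMeasurableFun.Build _ _ _ _ sum_pair measurable_sum_pair.

(* Law of the sum of two independent variables with laws V and W. *)
Definition convolution V W : distr R := distribution (V \x W)%E sum_pair.

Fixpoint conv_pow V (k : nat) : distr R :=
  if k is j.+1 then convolution V (conv_pow V j)
  else @dirac _ (measurableTypeR R) 0 R.

Definition exp_moment V gamma : \bar R :=
  (\int[V]_(y in [set y : R | (0 <= y)%R]) (expR (gamma * y)%R)%:E)%E.

Definition C_star G : \bar R :=
  limf_esup (fun x : R => (tail (conv_pow G 2) x / tail G x)%:E) (pinfty_nbhs R).

Definition class_OS G := (C_star G < +oo)%E.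

Definition multiples d : set R := range (fun k : int => k%:~R * d).

(* "Lattice" means carried by the multiples of some d > 0, without a shift;
   the span is the largest such d. *)
Definition lattice_span G d :=
  [/\ 0 < d, G (multiples d) = 1%E
    & forall d', 0 < d' -> G (multiples d') = 1%E -> d' <= d].

Definition lattice G := exists d, lattice_span G d.

Definition class_L gamma G :=
  [/\ forall x, 0 < tail G x,
      ~ (0 < gamma /\ lattice G) ->
        forall t, 0 < t ->
          tail G (x - t) / tail G x @[x --> +oo] --> expR (gamma * t)
    & 0 < gamma -> forall d, lattice_span G d ->
        forall m : nat, (0 < m)%N ->
          tail G (n%:R * d - m%:R * d) / tail G (n%:R * d)
            @[n --> \oo] --> expR (gamma * (m%:R * d))].

End Distributions.

(* Main.v *)
Require Import Defs.
From HB Require Import structures.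
From mathcomp Require Import all_boot all_order all_algebra.
From mathcomp Require Import all_classical all_reals all_analysis.
From mathcomp Require Import measurable_realfun ring lra.
Import Order.TTheory GRing.Theory Num.Theory.
Import numFieldNormedType.Exports.
Local Open Scope classical_set_scope.
Local Open Scope ring_scope.

(** The bound is an instance of Kesten's recursion. Fix a nonincreasing
positive function [H], comparable to the tail of [G], and suppose that
convolving with the part of [V] on [[0, x - A]] multiplies [H] by at most
[rho] for large [x]:
  [\int_[0, x - A] H (x - y) V(dy) <= rho * H x].
Splitting [X + S > x], with [X] of law [V] and [S] of law [V^*k], according to
whether [X <= x - A] turns a bound [b_k * H] of the tail of [V^*k] into the
bound [(rho * b_k + C) * H] of the tail of [V^*(k+1)]; for [rho > 1] this gives
[b_k <= C / (rho - 1) * (rho ^+ k - 1)] ([conv_pow_tail_le]). Taking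
[rho = (1 + eps) * (a + (2 + A1) * eps)], which exceeds [1] because
[a >= M(V, gamma) >= 1], and using [rho < M], one gets the theorem, with a
constant that does not depend on [M].

The integral is cut at [A]. On [[0, A]] the ratio [H (x - y) / H x] is, for
large [x], at most [(1 + eps) * expR (gamma * y)], which contributes
[(1 + eps) * M(V, gamma)]. On
[(A, x - A]] both summands of [X + Y > x], with [Y] of law [G], are large. By
Fubini the domination [tail V <= A1 * tail G] lets one replace the law of [X]
by [G] at the cost of a factor [A1] ([both_large_dominated]); and for two
independent variables of law [G] the event that the sum exceeds [x] although
both summands are large has probability at most
[C^*(G) - 2 * M(G, gamma) + eps] times [tail G x], since the two disjoint
events where one summand is at most [B] already account for about
[2 * M(G, gamma) * tail G x] ([both_large_near]).

One would like to take [H = tail G], but this fails when [gamma > 0] and [G] is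
lattice with span [d] while [V] is not: [tail G (x - y) / tail G x] can then
be near [expR (gamma * (y + d))] for some [y], and not [expR (gamma * y)]. The
remedy is to take for [H] the weighted sum of shifted tails
[\sum_(j < N) expR (- (gamma * h)) ^+ j * tail G (x - j * h)] with [h = d / N].
It satisfies [H (x - h) / H x --> expR (gamma * h)] ([cvg_smooth_ratio]), so
that the rounding error is only [expR (gamma * h)], as small as desired; and
the estimate on [(A, x - A]], being linear in the tail of [G], is inherited by
[H] with the same constant. This choice of [H] also works when [G] is not
lattice, so the two cases are separated only in [class_L_shift] and
[class_L_ae_ge]. *)

Set Implicit Arguments.
Unset Strict Implicit.
Unset Printing Implicit Defensive.

(** * Tails and convolution *)

Section Tails.
Context {R : realType}.
Implicit Types (V W G : distr R) (x y : R) (H : R -> R).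

Lemma tailE V x : (tail V x)%:E = V `]x, +oo[%classic.
Proof. by rewrite set_itvoy /tail fineK// -set_itvoy fin_num_measure. Qed.

Lemma tail_ge0 V x : 0 <= tail V x.
Proof. by rewrite -lee_fin tailE. Qed.

Lemma tail_le1 V x : tail V x <= 1.
Proof. by rewrite -lee_fin tailE probability_le1. Qed.

Lemma tail_anti V : {homo tail V : x y /~ x <= y}.
Proof.
move=> x y yx; rewrite -lee_fin !tailE le_measure ?inE//.
by apply: subset_itvr; rewrite bnd_simp.
Qed.

Lemma measurable_reflect H x (D : set R) : {homo H : x y /~ x <= y} ->
  measurable_fun D (fun y => (H (x - y))%:E).
Proof.
move=> Hanti; apply/measurable_EFinP; apply: measurable_funTS.
apply: (@measurableT_comp _ _ _ _ _ _ H _ (fun y => x - y)).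
  by apply: nonincreasing_measurable => // m n; exact: Hanti.
by apply: measurable_funB; [exact: measurable_cst|exact: measurable_id].
Qed.

Lemma tail_convolution V W x :
  (tail (convolution V W) x)%:E = (\int[V]_y (tail W (x - y))%:E)%E.
Proof.
rewrite tailE /= /distribution /pushforward /product_measure1.
apply: eq_integral => y _ /=; rewrite tailE.
rewrite xsectionE; congr (W _).
by apply/seteqP; split => z /=; rewrite /sum_pair /= !in_itv /= !andbT ltrBlDl.
Qed.

Lemma integral_nonneg_support V (f : R -> \bar R) : supported_nonneg V ->
  measurable_fun setT f -> (forall y, 0 <= f y)%E ->
  (\int[V]_y f y = \int[V]_(y in `[0%R, +oo[) f y)%E.
Proof.
move=> V0 mf f0.
have Vneg : V `]-oo, 0[%classic = 0%E.
  have /(congr1 (fun z => 1 - z)%E) := V0.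
  rewrite -probability_setC /=; last first.
    by rewrite -set_itvcy.
  by rewrite -set_itvcy setCitvr/= subee.
have -> : [set: R] = `]-oo, 0[%classic `|` `[0, +oo[%classic.
  by rewrite -setCitvr setUC setUv.
rewrite ge0_integral_setU//=.
- by rewrite (@null_set_integral _ _ _ V)// ?add0e//; exact: measurable_funTS.
- exact: measurable_funTS.
- by rewrite -setCitvr disj_set2E; apply/eqP; rewrite setICl.
Qed.

Lemma integral_le_setU V (A B C : set R) (f : R -> \bar R) :
  measurable A -> measurable B -> measurable C -> A `<=` B `|` C ->
  measurable_fun setT f -> (forall y, 0 <= f y)%E ->
  (\int[V]_(y in A) f y <= \int[V]_(y in B) f y + \int[V]_(y in C) f y)%E.
Proof.
move=> mA mB mC ABC mf f0.
have mfD (D : set R) : measurable_fun D f by exact: measurable_funTS.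
apply: (@le_trans _ _ (\int[V]_(y in (B `|` (C `\` B))%classic) f y)%E).
  apply: ge0_subset_integral => //; [|exact: mfD|by rewrite setUDr setDv setD0].
  by apply: measurableU => //; exact: measurableD.
rewrite ge0_integral_setU//.
- rewrite leeD2l//; apply: ge0_subset_integral => //; first exact: measurableD.
  exact: mfD.
- exact: measurableD.
- exact: mfD.
- by rewrite disj_set2E setDIK.
Qed.

(** The event [X + S > x] is cut according to whether the [V]-distributed
summand [X] exceeds [x - A]. If it does, the probability is simply bounded by
[tail V (x - A)]; otherwise [S] has to exceed [x - X >= A], where the bound on
the tail of [W] is available. *)
Lemma tail_convolution_le V W H (b A x : R) : supported_nonneg V ->
  0 <= b -> (forall z, 0 <= H z) -> {homo H : x y /~ x <= y} ->
  (forall z, A <= z -> tail W z <= b * H z) ->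
  ((tail (convolution V W) x)%:E <=
    b%:E * (\int[V]_(y in `[0%R, (x - A)%R]) (H (x - y))%:E)
    + (tail V (x - A))%:E)%E.
Proof.
move=> V0 b0 H0 Hanti WH.
have mW D : measurable_fun D (fun y : R => (tail W (x - y))%:E).
  by apply: (@measurable_reflect (tail W)); exact: tail_anti.
have W0 y : (0 <= (tail W (x - y))%:E)%E by rewrite lee_fin tail_ge0.
rewrite tail_convolution integral_nonneg_support//.
apply: le_trans (@integral_le_setU V _ `[0, x - A] `]x - A, +oo[ _ _ _ _ _ _ _)
  _ => //.
  move=> y /=; rewrite !in_itv /= !andbT => y0; rewrite y0 /=.
  by case: leP; [left|right].
apply: leeD.
  have mH D : measurable_fun D (fun y => (H (x - y))%:E).
    exact: measurable_reflect.
  rewrite -ge0_integralZl// => [||y _]; [|exact: mH|by rewrite lee_fin].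
  apply: ge0_le_integral => //; [exact: mW| |].
    by apply: emeasurable_funM => //; exact: mH.
  by move=> y /=; rewrite in_itv/= => /andP[_ yA]; rewrite lee_fin WH//; lra.
rewrite tailE -[leRHS]mul1e -integral_cst//.
apply: ge0_le_integral => //; first exact: mW.
by move=> y _; rewrite lee_fin tail_le1.
Qed.

(** By Fubini the product measure of [E] is the integral, with respect to the
common second marginal, of the masses that the first marginal gives to the
horizontal sections of [E]; these masses are compared pointwise. *)
Lemma product_measure_le V W G (c : R) (E : set (R * R)) : 0 <= c ->
  measurable E -> (forall z, V (ysection E z) <= c%:E * W (ysection E z))%E ->
  ((V \x G) E <= c%:E * (W \x G) E)%E.
Proof.
move=> c0 mE VW.
have swap (U : distr R) : ((U \x G) E = \int[G]_z U (ysection E z))%E.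
  rewrite (@product_measure_unique _ _ _ _ _ U G (U \x^ G)%E)// => A B mA mB.
  exact: product_measure2E.
rewrite !swap -ge0_integralZl//; last exact: (measurable_fun_ysection W).
apply: ge0_le_integral => //.
- exact: (measurable_fun_ysection V).
- by apply: emeasurable_funM => //; exact: (measurable_fun_ysection W).
Qed.

End Tails.

(** * Asymptotic shift ratios and smoothing *)

Section Asymptotics.
Context {R : realType}.
Implicit Types (G : distr R) (L : R -> R) (g h d x y : R).

Lemma cvg_shift_ratio_natmul L g h : (forall x, 0 < L x) ->
  L (x - h) / L x @[x --> +oo] --> expR (g * h) ->
  forall n, L (x - n%:R * h) / L x @[x --> +oo] --> expR (g * (n%:R * h)).
Proof.
move=> L0 Lh; elim=> [|n IH].
  rewrite mul0r mulr0 expR0.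
  under eq_fun do rewrite subr0 divff ?gt_eqF//.
  exact: cvg_cst.
have -> : expR (g * (n.+1%:R * h)) = expR (g * (n%:R * h)) * expR (g * h).
  by rewrite -expRD -natr1; congr expR; ring.
have -> : (fun x => L (x - n.+1%:R * h) / L x) =
    (fun x => L (x - h - n%:R * h) / L (x - h)) \* (fun x => L (x - h) / L x).
  apply/funext => x /=; rewrite mulrA divfK ?gt_eqF//; congr (L _ / _).
  by rewrite -natr1; ring.
apply: cvgM => //.
by rewrite (cvg_centerr h (fun x => L (x - n%:R * h) / L x)).
Qed.

(** The ratio is controlled along the multiples of [h] only; rounding [y] up to
such a multiple costs, by monotonicity, at most the factor [expR (g * h)],
which is absorbed by [c]. Since [y] is bounded, finitely many multiples are
involved, whence the uniformity in [y]. *)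
Lemma near_shift_ratio_le L g h c A : 0 <= g -> 0 < h -> (forall x, 0 < L x) ->
  {homo L : x y /~ x <= y} ->
  L (x - h) / L x @[x --> +oo] --> expR (g * h) -> expR (g * h) < c ->
  \forall x \near +oo, forall y, 0 <= y <= A ->
    L (x - y) <= c * expR (g * y) * L x.
Proof.
move=> g0 h0 L0 Lanti Lh hc.
(* [y] is rounded up to [n.+1 * h] with [n <= A / h]: indices up to
   [truncn (A / h) + 1]. *)
pose N := (Num.truncn (A / h)).+2.
have : \forall x \near +oo, forall n : 'I_N,
    L (x - n%:R * h) / L x < c * expR (g * (n%:R * h - h)).
  apply: filter_forall => n.
  apply: (cvgr_lt _ (@cvg_shift_ratio_natmul L g h L0 Lh n)).
  rewrite mulrBr expRB [c * _]mulrCA ltr_pMr ?expR_gt0//.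
  by rewrite ltr_pdivlMr ?expR_gt0// mul1r.
apply: filterS => x xN y /andP[y0 yA].
have yh : 0 <= y / h by rewrite divr_ge0// ltW.
have /andP[le_n lt_n] := truncn_itv yh.
set n := Num.truncn (y / h) in le_n lt_n.
have nN : (n.+1 < N)%N.
  by rewrite /N !ltnS le_truncn// ler_pM2r ?invr_gt0.
have := xN (Ordinal nN) => /=; rewrite ltr_pdivrMr// => /ltW xn.
apply: (@le_trans _ _ (L (x - n.+1%:R * h))).
  apply: Lanti; rewrite lerD2l lerN2 -ler_pdivrMr//; exact: ltW.
apply: (le_trans xn); rewrite (ler_pM2r (L0 x)).
rewrite ler_pM2l ?ler_expR ?(lt_trans _ hc) ?expR_gt0//.
by rewrite ler_wpM2l// -natr1 mulrDl mul1r addrK -ler_pdivlMr.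
Qed.

Lemma near_shift_ratio_grid_ge L g h c B : 0 < h ->
  (forall x, 0 < L x) ->
  L (x - h) / L x @[x --> +oo] --> expR (g * h) -> c < 1 ->
  \forall x \near +oo, forall n, n%:R * h <= B ->
    c * expR (g * (n%:R * h)) * L x <= L (x - n%:R * h).
Proof.
move=> h0 L0 Lh c1.
pose N := (Num.truncn (B / h)).+1.
have : \forall x \near +oo, forall n : 'I_N,
    c * expR (g * (n%:R * h)) < L (x - n%:R * h) / L x.
  apply: filter_forall => n.
  apply: (cvgr_gt _ (@cvg_shift_ratio_natmul L g h L0 Lh n)).
  by rewrite gtr_pMl ?expR_gt0.
apply: filterS => x xN n nB.
have nN : (n < N)%N.
  rewrite /N ltnS -[n](@natrK R) le_truncn// ler_pdivlMr//.
have := xN (Ordinal nN) => /=; rewrite ltr_pdivlMr//; exact: ltW.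
Qed.

(** Rounding [y] down to a multiple of [h] loses at most the factor
[expR (g * h)]. *)
Lemma near_shift_ratio_ge L g h c B : 0 <= g -> 0 < h -> 0 < c ->
  (forall x, 0 < L x) -> {homo L : x y /~ x <= y} ->
  L (x - h) / L x @[x --> +oo] --> expR (g * h) -> c * expR (g * h) < 1 ->
  \forall x \near +oo, forall y, 0 <= y <= B ->
    c * expR (g * y) * L x <= L (x - y).
Proof.
move=> g0 h0 c0 L0 Lanti Lh hc.
have := near_shift_ratio_grid_ge B h0 L0 Lh hc.
apply: filterS => x xB y /andP[y0 yB].
have yh : 0 <= y / h by rewrite divr_ge0// ltW.
have /andP[le_n lt_n] := truncn_itv yh.
set n := Num.truncn (y / h) in le_n lt_n.
have nhy : n%:R * h <= y by rewrite -ler_pdivlMr.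
apply: (@le_trans _ _ (L (x - n%:R * h))); last first.
  by apply: Lanti; rewrite lerD2l lerN2.
apply: le_trans (xB n (le_trans nhy yB)).
rewrite (ler_pM2r (L0 x)) -mulrA (ler_pM2l c0) -expRD ler_expR -mulrDr.
rewrite ler_wpM2l// -[X in X + _]mul1r -mulrDl.
by rewrite -ler_pdivrMr// ltW// addrC natr1.
Qed.

(** Summing [N] successive shifts of [L] by [h], with geometric weights matched
to the rate [g], refines the scale on which [L] behaves exponentially from
[N * h] to [h]: see [cvg_smooth_ratio]. *)
Definition smooth L g h (N : nat) x : R :=
  \sum_(j < N) expR (- (g * h)) ^+ j * L (x - j%:R * h).

Lemma smooth_anti L g h N : {homo L : x y /~ x <= y} ->
  {homo smooth L g h N : x y /~ x <= y}.
Proof.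
move=> Lanti x y yx; apply: ler_sum => j _.
by rewrite ler_wpM2l ?exprn_ge0 ?expR_ge0// Lanti// lerD2r.
Qed.

Lemma smooth_ge L g h N x : (forall x, 0 < L x) -> (0 < N)%N ->
  L x <= smooth L g h N x.
Proof.
case: N => // N L0 _; rewrite /smooth big_ord_recl/= expr0 mul1r mul0r subr0.
rewrite lerDl sumr_ge0// => j _.
by rewrite mulr_ge0 ?exprn_ge0 ?expR_ge0// ltW.
Qed.

(** Shifting by [h] moves every term of the sum to the next one, up to the
common factor [expR (g * h)]; only the first term is lost and only one new
term appears at the end. *)
Lemma smooth_shift L g h N x :
  smooth L g h N (x - h) = expR (g * h) *
    (smooth L g h N x - L x + expR (- (g * h)) ^+ N * L (x - N%:R * h)).
Proof.
rewrite /smooth; set q := expR (- _).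
have -> : \sum_(j < N) q ^+ j * L (x - j%:R * h) - L x
    + q ^+ N * L (x - N%:R * h) = \sum_(j < N) q ^+ j.+1 * L (x - j.+1%:R * h).
  have := @big_ord_recr R 0 +%R N (fun j => q ^+ j * L (x - j%:R * h)).
  rewrite big_ord_recl /= expr0 mul1r mul0r subr0.
  under eq_bigr do rewrite /bump /= add1n.
  by move=> e; apply: (addrI (L x)); rewrite e; ring.
rewrite mulr_sumr; apply: eq_bigr => j _.
rewrite exprS !mulrA /q expRxMexpNx_1 mul1r -natr1; congr (_ * L _).
by ring.
Qed.

(** By [smooth_shift] the error is governed by the difference between the term
gained, [q * L (x - d)] with [q = expR (- (g * d))], and the term lost, [L x].
This difference is [o(L x)] by hypothesis, and [L] is at most its smoothing. *)
Lemma cvg_smooth_ratio L g d N : (0 < N)%N -> (forall x, 0 < L x) ->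
  L (x - d) / L x @[x --> +oo] --> expR (g * d) ->
  let h := d / N%:R in
  smooth L g h N (x - h) / smooth L g h N x @[x --> +oo] --> expR (g * h).
Proof.
move=> N0 L0 Ld h.
have Nh : N%:R * h = d by rewrite mulrC divfK// pnatr_eq0 -lt0n.
have S0 x : 0 < smooth L g h N x by apply: lt_le_trans (smooth_ge _ _ _ _ _).
pose q := expR (- (g * h)) ^+ N.
pose r x := q * (L (x - d) / L x) - 1.
have q0 : q * expR (g * d) = 1.
  rewrite /q -expRM_natl -expRD -Nh -[RHS]expR0; congr expR; ring.
have r0 : `|r x| @[x --> +oo] --> (0 : R).
  rewrite -(normr0 R); apply: cvg_norm.
  rewrite -(subrr 1) -{1}q0; apply: cvgB; last exact: cvg_cst.
  exact: (@cvgM _ _ _ _ (cst q) _ q _ (@cvg_cst _ _ _ _ _) Ld).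
apply/cvgrPdist_le => e e0.
have e1 : 0 < e / expR (g * h) by rewrite divr_gt0 ?expR_gt0.
have : \forall x \near +oo, `|r x| <= e / expR (g * h) by exact: (cvgr_le _ r0).
apply: filterS => x xr.
have -> : expR (g * h) - smooth L g h N (x - h) / smooth L g h N x =
    - (expR (g * h) * (r x * (L x / smooth L g h N x))).
  rewrite smooth_shift Nh /r -/q; field.
  by rewrite !gt_eqF.
rewrite normrN normrM ger0_norm ?expR_ge0// mulrC -ler_pdivlMr ?expR_gt0//.
rewrite normrM (le_trans _ xr)// ler_piMr// ger0_norm.
  by rewrite ler_pdivrMr ?mul1r// smooth_ge.
by rewrite divr_ge0// ltW.
Qed.

Lemma smooth_le L g h N x : 0 <= g -> 0 < h -> {homo L : x y /~ x <= y} ->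
  (forall x, 0 < L x) ->
  smooth L g h N x <= N%:R * L (x - N%:R * h).
Proof.
move=> g0 h0 Lanti L0.
rewrite mulr_natl -[X in _ *+ X](card_ord N) -sumr_const; apply: ler_sum => j _.
rewrite -[leRHS]mul1r.
apply: ler_pM; rewrite ?exprn_ge0 ?expR_ge0//; first exact: ltW.
  by rewrite exprn_ile1 ?expR_ge0// -expR0 ler_expR oppr_le0 mulr_ge0// ltW.
by apply: Lanti; rewrite lerD2l lerN2 ler_pM2r// ler_nat ltnW.
Qed.

End Asymptotics.

(** * Distributions of class L(gamma) *)

Section LongTails.
Context {R : realType}.
Implicit Types (G : distr R) (g d x y : R).

Lemma measurable_multiples d : measurable (multiples d).
Proof.
apply: countable_measurable => [t|]; first exact: measurable_set1.
exact: sub_countable (card_image_le _ _) (countableP _).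
Qed.

Lemma null_off_multiples G d (A : set R) : G (multiples d) = 1%E ->
  measurable A -> A `&` multiples d = set0 -> G A = 0%E.
Proof.
move=> Gd mA Ad; have md := measurable_multiples d.
have Gc : G (~` multiples d) = 0%E by rewrite probability_setC// Gd subee.
apply: (@subset_measure0 _ _ _ G A (~` multiples d)) => //.
- exact: measurableC.
- exact/disjoints_subset.
Qed.

Lemma lattice_tail G d (n : int) x : 0 < d -> G (multiples d) = 1%E ->
  n%:~R * d <= x < (n + 1)%:~R * d -> tail G x = tail G (n%:~R * d).
Proof.
move=> d0 Gd /andP[nx xn].
have null : G `]n%:~R * d, x]%classic = 0%E.
  apply: (null_off_multiples Gd) => //.
  apply/seteqP; split=> // y /= []; rewrite in_itv/= => /andP[nk kx] [k _ ek].
  move: nk kx; rewrite -ek ltr_pM2r// ltr_int => nk /le_lt_trans /(_ xn).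
  by rewrite ltr_pM2r// ltr_int ltzD1 leNgt nk.
apply/EFin_inj; rewrite !tailE.
have -> : `]n%:~R * d, +oo[%classic = `]n%:~R * d, x] `|` `]x, +oo[.
  by rewrite -itv_bndbnd_setU// bnd_simp.
rewrite measureU//; first by rewrite [X in (X + _)%E]null add0e.
apply/seteqP; split=> // y /= []; rewrite !in_itv/= andbT => /andP[_ yx].
by rewrite ltNge yx.
Qed.

(** In the lattice case the definition of [class_L] only speaks of the sequence
of multiples of the span; since the tail is constant between two consecutive
multiples, the limit holds along all reals. *)
Lemma lattice_class_L_shift G g d : 0 < g -> class_L g G -> lattice_span G d ->
  tail G (x - d) / tail G x @[x --> +oo] --> expR (g * d).
Proof.
move=> g0 [_ _ /(_ g0 d)] /[swap] Gspan /(_ Gspan 1%N isT).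
case: Gspan => d0 Gd _; rewrite !mul1r => Gn.
have tr : Num.truncn (x / d) @[x --> +oo] --> \oo.
  apply/cvgnyPge => A.
  apply: filterS (nbhs_pinfty_ge (num_real (A%:R * d))) => x xA.
  have x0 : 0 <= x by rewrite (le_trans _ xA)// mulr_ge0// ltW.
  by rewrite truncn_ge_nat ?divr_ge0 ?(ltW d0)// ler_pdivlMr.
have := cvg_comp _ _ tr Gn; apply: cvg_trans; apply: near_eq_cvg.
apply: filterS (nbhs_pinfty_ge (num_real 0)) => x x0.
have := truncn_itv (divr_ge0 x0 (ltW d0)).
rewrite /= ler_pdivlMr// ltr_pdivrMr//; set n := Num.truncn _ => /andP[nx xn].
rewrite (@lattice_tail G d n x) ?(@lattice_tail G d (n%:Z - 1) (x - d))//.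
- by rewrite rmorphB /= mulrBl mul1r.
- rewrite subrK rmorphB/= mulrBl mul1r lerB// ltrBlDr -[X in _ + X]mul1r -mulrDl.
  by rewrite natr1.
- by rewrite nx rmorphD /= natr1.
Qed.

(** A single shift with the expected limit is all that the smoothing needs, and
it exists whether or not [G] is lattice. *)
Lemma class_L_shift G g : class_L g G -> exists2 d, 0 < d &
  tail G (x - d) / tail G x @[x --> +oo] --> expR (g * d).
Proof.
move=> GL; have [[g0 [d Gd]]|nl] := pselect (0 < g /\ lattice G).
  by exists d; [case: Gd|exact: lattice_class_L_shift].
by exists 1 => //; case: GL => _ /(_ nl 1 ltr01).
Qed.

(** For lattice [G] and [g > 0] the lower bound fails for general [y], but it
does hold at the multiples of the span, which carry all the mass of [G]; this is why it is
stated almost everywhere. Otherwise rounding down to a fine enough grid gives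
it for every [y]. *)
Lemma class_L_ae_ge G g c B : 0 <= g -> class_L g G ->
  0 < c < 1 -> \forall x \near +oo, {ae G, forall y, 0 <= y <= B ->
    c * expR (g * y) * tail G x <= tail G (x - y)}.
Proof.
move=> g0 GL /andP[c0 c1].
have G0 : forall x, 0 < tail G x by case: GL.
have [[gpos [d Gd]]|nl] := pselect (0 < g /\ lattice G).
  have Gr := lattice_class_L_shift gpos GL Gd; case: Gd => d0 Gd _.
  have := near_shift_ratio_grid_ge B d0 G0 Gr c1.
  apply: filterS => x xB.
  have mC := measurableC (measurable_multiples d).
  exists (~` multiples d); split => //.
    by apply: (null_off_multiples Gd) => //; rewrite setICl.
  apply: subsetC => _ [k _ <-] /andP[].
  rewrite pmulr_lge0// ler0z; case: k => // n _; exact: xB.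
(* A step for which the rounding factor [expR (g * h)] is less than [c^-1]. *)
pose h : R := if g == 0 then 1 else - ln c / g / 2.
have [h0 hc] : 0 < h /\ c * expR (g * h) < 1.
  rewrite /h; have [->|gN0] := eqVneq g 0.
    by rewrite mul0r expR0 mulr1.
  have g1 : 0 < g by rewrite lt0r gN0.
  have lc : ln c < 0 by rewrite ln_lt0// c0.
  split; first by rewrite !divr_gt0// oppr_gt0.
  rewrite -{1}(lnK c0) -expRD expR_lt1.
  rewrite (_ : g * _ = - ln c / 2); last by field.
  by lra.
have Gr : tail G (x - h) / tail G x @[x --> +oo] --> expR (g * h).
  by case: GL => _ /(_ nl h h0).
have := near_shift_ratio_ge B g0 h0 c0 G0 (@tail_anti _ G) Gr hc.
by apply: filterS => x xB; exact: aeW.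
Qed.

End LongTails.

(** * Convolution square and the event of two large summands *)

Section ConvolutionSquare.
Context {R : realType}.
Implicit Types (V W G : distr R) (g d x y B : R).

(** Beyond some [x0] the limit gives the bound; before it the tail at [x] is at
least [tail G x0], while the shifted tail is at most [1]. *)
Lemma tail_shift_bound G g d : (forall x, 0 < tail G x) ->
  tail G (x - d) / tail G x @[x --> +oo] --> expR (g * d) ->
  exists2 c, 0 < c & forall x, tail G (x - d) <= c * tail G x.
Proof.
move=> G0 Gd.
have e1 : expR (g * d) < expR (g * d) + 1 by rewrite ltrDl.
have [x0 [_ x0P]] := cvgr_le _ Gd _ e1.
exists (expR (g * d) + 1 + (tail G x0)^-1).
  by rewrite !addr_gt0 ?expR_gt0 ?invr_gt0.
move=> x; rewrite mulrDl; have [xx0|xx0] := ltP x0 x.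
  apply: ler_wpDr; first by rewrite mulr_ge0 ?invr_ge0 ?ltW.
  by rewrite -ler_pdivrMr// x0P.
apply: ler_wpDl; first by rewrite mulr_ge0 ?addr_ge0 ?expR_ge0 ?tail_ge0.
by rewrite (le_trans (tail_le1 _ _))// mulrC ler_pdivlMr// mul1r tail_anti.
Qed.

Lemma C_star_near G c : (forall x, 0 < tail G x) -> (C_star G < c%:E)%E ->
  \forall x \near +oo, tail (conv_pow G 2) x <= c * tail G x.
Proof.
move=> G0 /ereal_inf_lt[_ [A FA <-] Ac].
apply: filterS FA => x Ax.
rewrite -ler_pdivrMr// -lee_fin (le_trans _ (ltW Ac))//.
by apply: ereal_sup_ubound; exists x.
Qed.

Lemma tail_convolution_dirac G x :
  tail (convolution G (@dirac _ (measurableTypeR R) 0 R)) x = tail G x.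
Proof.
apply/EFin_inj; rewrite tail_convolution tailE.
rewrite -[X in _ = _ X]setIT -integral_indic//.
apply: eq_integral => y _; rewrite tailE/= diracE indicE; congr (_%:R%:E).
by rewrite !mem_setE !in_itv/= !andbT subr_lt0.
Qed.

Lemma tail_conv_pow2 G x :
  (tail (conv_pow G 2) x)%:E = (\int[G]_y (tail G (x - y))%:E)%E.
Proof.
rewrite tail_convolution; apply: eq_integral => y _.
by rewrite tail_convolution_dirac.
Qed.

Definition both_large B x : set (measurableTypeR R * measurableTypeR R) :=
  (`]B, +oo[ `*` `]B, +oo[) `&` sum_pair @^-1` `]x, +oo[.

Lemma both_largeP B x u v :
  both_large B x (u, v) <-> [/\ B < u, B < v & x < u + v].
Proof.
rewrite /both_large /sum_pair /=; split => [[[/=]]|[Bu Bv xuv]].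
  by rewrite !in_itv/= !andbT.
by split; [split|] => /=; rewrite in_itv/= andbT.
Qed.

Lemma measurable_sum_gt x :
  measurable ((@sum_pair R) @^-1` `]x, +oo[).
Proof. by rewrite -[X in measurable X]setTI; exact: measurable_sum_pair. Qed.

Lemma measurable_both_large B x : measurable (both_large B x).
Proof.
by apply: measurableI; [exact: measurableX|exact: measurable_sum_gt].
Qed.

(** When [x >= 2 * B] two summands in [[0, B]] cannot add up to more than [x].
The event that the sum exceeds [x] therefore contains three disjoint parts:
the first summand is in [[0, B]], the second is, or both exceed [B]. *)
Lemma both_large_le G B x : 0 <= B -> B + B <= x ->
  (2%:E * (\int[G]_(y in `[0%R, B]) (tail G (x - y))%:E)
    + (G \x G) (both_large B x) <= (tail (conv_pow G 2) x)%:E)%E.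
Proof.
move=> B0 Bx.
pose S := (@sum_pair R) @^-1` `]x, +oo[.
pose P1 := S `&` (`[0, B] `*` setT).
pose P2 := S `&` (setT `*` `[0, B]).
have mS : measurable S by exact: measurable_sum_gt.
have mP1 : measurable P1 by apply: measurableI => //; exact: measurableX.
have mP2 : measurable P2 by apply: measurableI => //; exact: measurableX.
have mJ := measurable_both_large B x.
have -> : (tail (conv_pow G 2) x)%:E = ((G \x G) S)%E.
  rewrite tail_conv_pow2 /product_measure1; apply: eq_integral => y _.
  rewrite tailE/= xsectionE; congr (G _).
  by rewrite /S; apply/seteqP; split => z /=;
    rewrite /sum_pair/= !in_itv/= !andbT ltrBlDl.
pose I := (\int[G]_(y in `[0%R, B]) (tail G (x - y))%:E)%E.
have secI : (I <= \int[G]_y G (xsection P1 y))%E.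
  apply: (@le_trans _ _ (\int[G]_(y in `[0%R, B]) G (xsection P1 y))%E).
    rewrite (@eq_integral _ _ _ G _ (fun y => (tail G (x - y))%:E))// => y.
    rewrite inE/= => yB; rewrite tailE/= xsectionE /P1 /S; congr (G _).
    apply/seteqP; split => z /=; rewrite /sum_pair/= !in_itv/= !andbT ltrBlDl.
      by case.
    by [].
  by apply: ge0_subset_integral => //; exact: measurable_fun_xsection.
have I1 : (I <= (G \x G) P1)%E by [].
(* [P2] is the mirror image of [P1]: integrating in the other order gives the
   same sections. *)
have I2 : (I <= (G \x G) P2)%E.
  rewrite (@product_measure_unique _ _ _ _ _ G G (G \x^ G)%E)//; last first.
    by move=> A1 A2 mA1 mA2; exact: product_measure2E.
  apply: (le_trans secI); rewrite le_eqVlt; apply/orP; left; apply/eqP.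
  apply: eq_integral => y _ /=; rewrite xsectionE ysectionE /P1 /P2 /S.
  congr (G _).
  apply/seteqP; split => z /=; rewrite /sum_pair/= addrC;
    by move=> -[? []].
have disj12 : P1 `&` P2 = set0.
  apply/seteqP; split=> // -[u v] [[/= + [+ _]] [_ [_]]] /=.
  rewrite /S /sum_pair/= !in_itv/= andbT => ? /andP[? ?] /andP[? ?]; lra.
have disjJ : (P1 `|` P2) `&` both_large B x = set0.
  apply/seteqP; split=> // -[u v] [[[_ [/= w _]]|[_ [_ /= w]]] [[/= Bu Bv] _]];
  by move: w Bu Bv; rewrite !in_itv/= !andbT => /andP[_]; rewrite leNgt => /negP.
apply: (@le_trans _ _ ((G \x G) ((P1 `|` P2) `|` both_large B x))%E); last first.
  apply: le_measure; rewrite ?inE//; last by move=> z [[|]|] [].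
  by apply: measurableU => //; exact: measurableU.
rewrite measureU//; last exact: measurableU.
rewrite measureU// leeD2r//.
rewrite (_ : 2%:E = 1 + 1)%E// ge0_muleDl// !mul1e.
exact: leeD.
Qed.

End ConvolutionSquare.

(** * Contribution of two large summands *)

Section TwoLargeSummands.
Context {R : realType}.
Implicit Types (V W G : distr R) (g d x y B : R).

Lemma measurable_EFin_expM g (D : set R) :
  measurable_fun D (fun y => (expR (g * y))%:E).
Proof.
apply/measurable_EFinP; apply: measurable_funTS.
by apply: measurableT_comp => //; exact: mulrl_measurable.
Qed.

Lemma exp_moment_approx G g r : (r%:E < exp_moment G g)%E ->
  exists2 B, 0 <= B &
  (r%:E <= \int[G]_(y in `[0%R, B]) (expR (g * y))%:E)%E.
Proof.
pose F n : set (measurableTypeR R) := `[0, 0 + n%:R]%classic.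
have F_homo : {homo F : n m / (n <= m)%N >-> (n <= m)%O}.
  move=> n m nm; apply/subsetPset; apply: subset_itvl.
  by rewrite bnd_simp lerD2l ler_nat.
have e0 y : (0 <= (expR (g * y))%:E)%E by rewrite lee_fin expR_ge0.
have := @ge0_nondecreasing_set_cvg_integral _ _ _ F
  (fun y => (expR (g * y))%:E) G F_homo (fun _ => measurable_itv _)
  (fun _ => @measurable_EFin_expM _ _) (fun _ _ _ => e0 _).
rewrite -itv_bndy_bigcup_BRight set_itvcy => cvgI rG.
have [n _ /(_ n (leqnn n)) rG2] : \forall n \near \oo,
    (r%:E <= \int[G]_(y in F n) (expR (g * y))%:E)%E.
  apply: lte_lim.
  - move=> n m nm; apply: ge0_subset_integral; rewrite ?/F//.
      exact: measurable_EFin_expM.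
    exact/subsetPset/F_homo.
  - exact: cvgP cvgI.
  - by rewrite (cvg_lim _ cvgI).
by exists n%:R => //; move: rG2; rewrite /F add0r.
Qed.

(** A [B] such that [[0, B]] carries the exponential moment up to [e / 2] is
chosen first; the lower bound of [class_L_ae_ge] on [[0, B]] is then
integrated. *)
Lemma head_integral_ge G g m e : 0 <= g -> class_L g G ->
  exp_moment G g = m%:E -> 0 < e -> exists2 B, 0 <= B &
  \forall x \near +oo, (((m - e) * tail G x)%:E <=
    \int[G]_(y in `[0%R, B]) (tail G (x - y))%:E)%E.
Proof.
move=> g0 GL Gm e0.
have m0 : 0 <= m.
  rewrite -lee_fin -Gm; apply: integral_ge0 => y _.
  by rewrite lee_fin expR_ge0.
have [|B B0 IB] := @exp_moment_approx G g (m - e / 2).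
  by rewrite Gm lte_fin; lra.
exists B => //.
(* Chosen so that [c * (m - e / 2) >= m - e]. *)
pose c := 1 - e / (2 * (m + e)).
have me0 : 0 < 2 * (m + e) by lra.
have c01 : 0 < c < 1.
  rewrite /c subr_gt0 ltrBlDr ltrDl divr_gt0// andbT ltr_pdivrMr//; lra.
have cm : m - e <= c * (m - e / 2).
  rewrite /c mulrBl mul1r.
  suff : e / (2 * (m + e)) * (m - e / 2) <= e / 2 by lra.
  rewrite mulrAC ler_pdivrMr//.
  have : 0 <= e * e by rewrite mulr_ge0// ltW.
  nra.
have := class_L_ae_ge B g0 GL c01; apply: filterS => x xB.
apply: (@le_trans _ _
    ((c * tail G x)%:E * \int[G]_(y in `[0%R, B]) (expR (g * y))%:E)%E).
  apply: (@le_trans _ _ ((c * tail G x)%:E * (m - e / 2)%:E)%E).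
    by rewrite -EFinM lee_fin mulrAC ler_wpM2r ?tail_ge0.
  rewrite lee_wpmul2l// lee_fin mulr_ge0 ?tail_ge0//.
  by case/andP: c01 => /ltW.
have ct0 : 0 <= c * tail G x.
  by rewrite mulr_ge0 ?tail_ge0//; case/andP: c01 => /ltW.
rewrite -ge0_integralZl_EFin//; last exact: measurable_EFin_expM.
apply: ae_ge0_le_integral => //.
- by move=> y _; rewrite -EFinM lee_fin mulr_ge0 ?expR_ge0.
- by apply: emeasurable_funM => //; exact: measurable_EFin_expM.
- by move=> y _; rewrite lee_fin tail_ge0.
- by apply: (@measurable_reflect _ (tail G)); exact: tail_anti.
- have [N [mN GN sub]] := xB; exists N; split=> //.
  apply: subset_trans sub; apply: subsetC => y /= yB yI.
  by rewrite -EFinM lee_fin mulrAC yB//; move: yI; rewrite in_itv.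
Qed.

(** Of the at most [C_star G + e / 3] times [tail G x] that the convolution
square puts above [x], twice [m - e / 3] times [tail G x] is accounted for by
the pairs with a summand in [[0, B]]. *)
Lemma both_large_near G g m cs e : 0 <= g -> class_L g G ->
  exp_moment G g = m%:E -> C_star G = cs%:E -> 0 < e ->
  exists2 B, 0 <= B & \forall x \near +oo,
    ((G \x G) (both_large B x) <= ((cs - 2 * m + e) * tail G x)%:E)%E.
Proof.
move=> g0 GL Gm Gcs e0.
have G0 : forall x, 0 < tail G x by case: GL.
have e3 : 0 < e / 3 by rewrite divr_gt0.
have [B B0 head] := head_integral_ge g0 GL Gm e3.
exists B => //.
have cs_lt : (C_star G < (cs + e / 3)%:E)%E by rewrite Gcs lte_fin ltrDl.
have C2 := C_star_near G0 cs_lt.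
have B2 := nbhs_pinfty_ge (num_real (B + B)).
near=> x.
have xhead : (((m - e / 3) * tail G x)%:E <=
    \int[G]_(y in `[0%R, B]) (tail G (x - y))%:E)%E by near: x.
have xC2 : tail (conv_pow G 2) x <= (cs + e / 3) * tail G x by near: x.
have xB : B + B <= x by near: x.
have J : ((2 * ((m - e / 3) * tail G x))%:E + (G \x G) (both_large B x) <=
    ((cs + e / 3) * tail G x)%:E)%E.
  apply: (@le_trans _ _ (tail (conv_pow G 2) x)%:E); last by rewrite lee_fin.
  apply: le_trans (both_large_le G B0 xB).
  by rewrite leeD2r// EFinM lee_wpmul2l.
move: J; rewrite -leeBrDl// -EFinB => /le_trans; apply.
by rewrite lee_fin -subr_ge0 (_ : _ - _ = 0)//; field.
Unshelve. all: by end_near. Qed.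

(** The bound of [both_large_near] is a bound on a probability, hence its
constant is nonnegative. *)
Lemma C_star_ge G g m cs : 0 <= g -> class_L g G ->
  exp_moment G g = m%:E -> C_star G = cs%:E -> 0 <= cs - 2 * m.
Proof.
move=> g0 GL Gm Gcs; apply/ler_addgt0Pr => e e0.
have G0 : forall x, 0 < tail G x by case: GL.
have [B B0 [M [_ MP]]] := both_large_near g0 GL Gm Gcs e0.
have := le_trans (measure_ge0 (G \x G)%E _) (MP (M + 1) _).
rewrite ltrDl ltr01 => /(_ isT); rewrite lee_fin pmulr_lge0//.
Qed.

Lemma both_large_dominated V G c B x : 0 <= c -> 0 <= B ->
  (forall z, 0 <= z -> tail V z <= c * tail G z) ->
  ((V \x G) (both_large B x) <= c%:E * (G \x G) (both_large B x))%E.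
Proof.
move=> c0 B0 VG; apply: product_measure_le => //.
  exact: measurable_both_large.
move=> z; have [Bz|zB] := ltP B z.
  have -> : ysection (both_large B x) z = `]Num.max B (x - z), +oo[%classic.
    rewrite ysectionE; apply/seteqP; split => y /=;
    rewrite in_itv/= andbT gt_max ltrBlDr.
      by move=> /both_largeP[-> _ ->].
    by move=> /andP[By xyz]; apply/both_largeP.
  by rewrite -!tailE -EFinM lee_fin VG// le_max B0.
have -> : ysection (both_large B x) z = set0.
  rewrite ysectionE; apply/seteqP; split => // y /=.
  by move=> /both_largeP[_]; rewrite ltNge zB.
by rewrite !measure0 mule0.
Qed.

(** For [A < y <= x - A], a second summand exceeding [x - y - u] exceeds
[A - u >= B], so it makes both summands large. The shift [u] serves the terms
of a smoothed tail. *)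
Lemma middle_integral_le V G A B u x : 0 <= u -> B + u <= A ->
  (\int[V]_(y in `]A, (x - A)%R]) (tail G (x - y - u))%:E <=
   (V \x G) (both_large B (x - u)))%E.
Proof.
move=> u0 BA.
have mJ := measurable_both_large B (x - u).
have mG : measurable_fun setT (fun y => G (xsection (both_large B (x - u)) y)).
  exact: measurable_fun_xsection.
apply: (@le_trans _ _ (\int[V]_(y in `]A, (x - A)%R])
    G (xsection (both_large B (x - u)) y))%E); last first.
  by apply: ge0_subset_integral.
apply: ge0_le_integral => //.
- by move=> y _; rewrite lee_fin tail_ge0.
- apply: (@measurable_reflect _ (fun z => tail G (z - u))) => y z yz.
  by apply: tail_anti; rewrite lerD2r.
- exact: measurable_funTS.
move=> y /=; rewrite in_itv/= => /andP[Ay yA]; rewrite tailE.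
apply: le_measure; rewrite ?inE//; first exact: measurable_xsection.
rewrite xsectionE => z /=; rewrite in_itv/= andbT => yz.
by apply/both_largeP; split; lra.
Qed.

End TwoLargeSummands.

(** * Recursion for the convolution powers *)

Section Recursion.
Context {R : realType}.
Implicit Types (V W G : distr R) (g d x y B : R).

(** The integral is linear in the tail of [G], so a bound proportional to
[tail G] yields the same bound, with the same constant, for its smoothing. *)
Lemma middle_smooth_le V G g h N A B k : 0 < h -> B + N%:R * h <= A ->
  (\forall x \near +oo,
    ((V \x G) (both_large B x) <= (k * tail G x)%:E)%E) ->
  \forall x \near +oo,
    (\int[V]_(y in `]A, (x - A)%R]) (smooth (tail G) g h N (x - y))%:E <=
     (k * smooth (tail G) g h N x)%:E)%E.
Proof.
move=> h0 BA [x0 [_ x0P]].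
apply: filterS (nbhs_pinfty_gt (num_real (x0 + N%:R * h))) => x xx0.
have q0 j : 0 <= expR (- (g * h)) ^+ j by rewrite exprn_ge0 ?expR_ge0.
have jN (j : 'I_N) : j%:R * h <= N%:R * h.
  by rewrite ler_pM2r// ler_nat ltnW.
have mG u (D : set R) : measurable_fun D (fun y => (tail G (x - y - u))%:E).
  apply: (@measurable_reflect _ (fun z => tail G (z - u))) => y z yz.
  by apply: tail_anti; rewrite lerD2r.
have mqG j (D : set R) : measurable_fun D
    (fun y => (expR (- (g * h)) ^+ j * tail G (x - y - j%:R * h))%:E).
  under eq_fun do rewrite EFinM.
  by apply: emeasurable_funM => //; exact: mG.
under eq_integral do rewrite /smooth -sumEFin.
rewrite ge0_integral_sum//; first last.
- by move=> j y _; rewrite lee_fin mulr_ge0 ?tail_ge0.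
- by move=> j; apply: mqG.
rewrite /smooth mulr_sumr -sumEFin; apply: lee_sum => j _.
under eq_integral do rewrite EFinM.
rewrite ge0_integralZl_EFin//; first last.
- exact: mG.
- by move=> y _; rewrite lee_fin tail_ge0.
rewrite mulrCA EFinM lee_wpmul2l ?lee_fin//.
have := jN j => jNj.
apply: le_trans (@middle_integral_le _ _ _ _ B _ _ _ _) _.
- by rewrite mulr_ge0// ltW.
- lra.
- by apply: x0P; lra.
Qed.

Lemma kernel_integral_le V g (H : R -> R) mV c k A : 0 <= c ->
  exp_moment V g = mV%:E -> (forall z, 0 <= H z) -> {homo H : x y /~ x <= y} ->
  (\forall x \near +oo, forall y, 0 <= y <= A ->
     H (x - y) <= c * expR (g * y) * H x) ->
  (\forall x \near +oo,
    (\int[V]_(y in `]A, (x - A)%R]) (H (x - y))%:E <= (k * H x)%:E)%E) ->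
  \forall x \near +oo,
    (\int[V]_(y in `[0%R, (x - A)%R]) (H (x - y))%:E <=
     ((c * mV + k) * H x)%:E)%E.
Proof.
move=> c0 VmV H0 Hanti head; apply: filterS2 head => x head mid.
have mH (D : set R) : measurable_fun D (fun y => (H (x - y))%:E).
  exact: measurable_reflect.
have cH0 : 0 <= c * H x by rewrite mulr_ge0.
apply: le_trans (@integral_le_setU _ V _ `[0, A] `]A, x - A] _ _ _ _ _ _ _)
  _ => //.
- move=> y /=; rewrite !in_itv/= => /andP[-> ->]; rewrite andbT.
  by case: leP; [left|right].
- by move=> y; rewrite lee_fin.
rewrite mulrDl EFinD; apply: leeD mid.
rewrite mulrAC EFinM -VmV /exp_moment -set_itvcy.
apply: (@le_trans _ _
    ((c * H x)%:E * \int[V]_(y in `[0%R, A]) (expR (g * y))%:E)%E).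
  rewrite -ge0_integralZl_EFin//; last exact: measurable_EFin_expM.
  apply: ge0_le_integral => //; first by move=> y _; rewrite lee_fin.
  - exact: mH.
  - by apply: emeasurable_funM => //; exact: measurable_EFin_expM.
  - move=> y /=; rewrite in_itv => yA.
    by rewrite -EFinM lee_fin mulrAC head.
apply: lee_wpmul2l; first by rewrite lee_fin.
apply: ge0_subset_integral => //; first exact: measurable_EFin_expM.
by apply: subset_itvl; rewrite bnd_simp.
Qed.

(** Kesten's recursion. In the alternative, [1 <= C * H x] disposes of the
bounded values of [x], where probabilities are just bounded by [1]. The factor
[C / (rho - 1) * (rho ^+ k - 1)] is the solution of [b' = rho * b + C] starting
at [b = 0], the tail of the Dirac mass at [0] vanishing at every [x >= 0]. *)
Lemma conv_pow_tail_le V (H : R -> R) rho C A : supported_nonneg V ->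
  (forall z, 0 <= H z) -> {homo H : x y /~ x <= y} ->
  0 <= A -> 1 < rho -> 0 <= C ->
  (forall x, 0 <= x -> 1 <= C * H x \/
    (\int[V]_(y in `[0%R, (x - A)%R]) (H (x - y))%:E <= (rho * H x)%:E)%E /\
    tail V (x - A) <= C * H x) ->
  forall k x, 0 <= x ->
    tail (conv_pow V k) x <= C / (rho - 1) * (rho ^+ k - 1) * H x.
Proof.
move=> Vpos H0 Hanti A0 rho1 C0 step; elim=> [|k IH] x x0.
  rewrite expr0 subrr mulr0 mul0r -lee_fin tailE /= diracE mem_setE.
  by rewrite in_itv/= ltNge x0.
have rho_gt0 : 0 < rho - 1 by rewrite subr_gt0.
pose b := C / (rho - 1) * (rho ^+ k - 1).
have b0 : 0 <= b.
  rewrite mulr_ge0 ?divr_ge0 ?(ltW rho_gt0)// subr_ge0.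
  by rewrite exprn_ege1// ltW.
have bS : C / (rho - 1) * (rho ^+ k.+1 - 1) = b * rho + C.
  by rewrite /b exprS; field; rewrite gt_eqF.
have WH z : A <= z -> tail (conv_pow V k) z <= b * H z.
  by move=> Az; apply: IH; exact: le_trans Az.
rewrite bS mulrDl; clearbody b => {bS}.
have [CH|[int tV]] := step x x0.
  rewrite (le_trans (tail_le1 _ _))// (le_trans CH)// lerDr.
  by rewrite !mulr_ge0// (le_trans _ (ltW rho1)).
rewrite -lee_fin; apply: le_trans (tail_convolution_le x Vpos b0 H0 Hanti WH) _.
by rewrite EFinD leeD ?lee_fin// -mulrA EFinM lee_wpmul2l// lee_fin.
Qed.

(** The big-O hypothesis bounds the ratio beyond some [x0], and before it the
tail of [G] is at least [tail G x0]. *)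
Lemma tail_ratio_bounded V G : (forall x, 0 < tail G x) ->
  tail V =O_+oo tail G ->
  exists r : R, [/\ 0 <= r,
    ereal_sup [set (tail V x / tail G x)%:E | x in [set x : R | 0 <= x]] = r%:E
    & forall x, 0 <= x -> tail V x <= r * tail G x].
Proof.
move=> G0 /eqO_exP[c c0 [x0 [_ x0P]]].
set S := [set _ | _ in _].
have ubS : (ereal_sup S <= (c + (tail G x0)^-1)%:E)%E.
  apply: ge_ereal_sup => _ [x x_ge0 <-]; rewrite lee_fin.
  have [xx0|xx0] := ltP x0 x.
    have := x0P x xx0; rewrite !ger0_norm ?tail_ge0// -ler_pdivrMr// => h.
    by rewrite (le_trans h)// lerDl invr_ge0 tail_ge0.
  rewrite (@le_trans _ _ (tail G x0)^-1)// ?lerDr ?(ltW c0)//.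
  rewrite ler_pdivrMr// mulrC ler_pdivlMr//.
  by rewrite (le_trans _ (tail_anti G xx0))// ler_piMl ?tail_ge0 ?tail_le1.
have lbS x : 0 <= x -> ((tail V x / tail G x)%:E <= ereal_sup S)%E.
  by move=> x_ge0; apply: ereal_sup_ubound; exists x.
have S0 : (0 <= ereal_sup S)%E.
  by apply: le_trans (lbS 0 _) => //; rewrite lee_fin divr_ge0 ?tail_ge0.
have Sfin : ereal_sup S \is a fin_num.
  by rewrite ge0_fin_numE// (le_lt_trans ubS)// ltry.
exists (fine (ereal_sup S)); split; first exact: fine_ge0.
  by rewrite fineK.
move=> x x_ge0; rewrite -ler_pdivrMr// -lee_fin fineK//; exact: lbS.
Qed.

Lemma C_star_fin G : class_OS G -> exists cs : R, C_star G = cs%:E.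
Proof.
move=> Gos; exists (fine (C_star G)); rewrite fineK// ge0_fin_numE//.
apply: le_ereal_inf_tmp => _ [A FA <-].
have /filter_ex[x Ax] : (pinfty_nbhs R) A by [].
apply: (@le_trans _ _ (tail (conv_pow G 2) x / tail G x)%:E).
  by rewrite lee_fin divr_ge0 ?tail_ge0.
by apply: ereal_sup_ubound; exists x.
Qed.

Lemma exp_moment_ge1 V g : 0 <= g -> supported_nonneg V ->
  (1 <= exp_moment V g)%E.
Proof.
move=> g0 Vpos; rewrite -Vpos /exp_moment -set_itvcy.
rewrite -[leLHS]mul1e -integral_cst//.
apply: ge0_le_integral => //; first exact: measurable_EFin_expM.
move=> y /=; rewrite in_itv/= andbT => y0.
by rewrite lee_fin -expR0 ler_expR mulr_ge0.
Qed.

Lemma exists_fine_step g d e : 0 <= g -> 0 < d -> 0 < e ->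
  exists2 N, (0 < N)%N & expR (g * (d / N%:R)) < 1 + e.
Proof.
move=> g0 d0 e0.
have e1 : 1 < 1 + e by rewrite ltrDl.
have le0 : 0 < ln (1 + e) by rewrite ln_gt0.
exists (Num.truncn (g * d / ln (1 + e))).+1 => //.
rewrite -[ltRHS]lnK ?ltr_expR ?posrE ?(lt_trans ltr01)//.
by rewrite mulrA ltr_pdivrMr// [X in _ < X]mulrC -ltr_pdivrMr// truncnS_gt.
Qed.

End Recursion.

Theorem proposition6p3 (R : realType) (V G : distr R) (gamma : R)
  (A1 a : \bar R) :
  supported_nonneg V -> supported_nonneg G ->
  0 <= gamma -> class_L gamma G -> class_OS G ->
  (exp_moment G gamma < +oo)%E ->
  tail V =O_+oo tail G ->
  A1 = ereal_sup [set (tail V x / tail G x)%:E | x in [set x : R | 0 <= x]] ->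
  a = (exp_moment V gamma + A1 * (C_star G - 2%:E * exp_moment G gamma))%E ->
  forall eps : R, 0 < eps ->
  exists K : R, 0 < K /\
    forall M : R,
      (a < M%:E)%E -> (M%:E < 1 + a)%E ->
      ((1 + eps)%:E * (a + (2%:E + A1) * eps%:E) < M%:E)%E ->
      forall (k : nat) (x : R), (1 <= k)%N -> 0 <= x ->
        tail (conv_pow V k) x <= K * M ^+ k * tail G x.
Proof.
move=> Vpos Gpos g0 GL Gos Gfin VG A1E aE eps eps0.
have G0 : forall x, 0 < tail G x by case: GL.
have [r [r0 rE VrG]] := tail_ratio_bounded G0 VG.
have [cs Gcs] := C_star_fin Gos.
have [m Gm] : exists m : R, exp_moment G gamma = m%:E.
  exists (fine (exp_moment G gamma)); rewrite fineK// ge0_fin_numE//.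
  by rewrite (le_trans _ (exp_moment_ge1 g0 Gpos)).
have V1 := exp_moment_ge1 g0 Vpos.
move: aE; rewrite A1E rE Gcs Gm -EFinM.
case VmV : (exp_moment V gamma) => [mV| |]; last first.
- by move: V1; rewrite VmV.
- (* If the exponential moment of [V] is infinite then so is [a], and no [M]
     satisfies [a < M]. *)
  by move=> ->; exists 1; split=> // M; rewrite addye.
move=> aE.
have mV1 : 1 <= mV by rewrite -lee_fin -VmV.
have excess := C_star_ge g0 GL Gm Gcs.
have [d d0 Gd] := class_L_shift GL.
have [N N0 Nfine] := exists_fine_step g0 d0 eps0.
set h := d / N%:R in Nfine.
have h0 : 0 < h by rewrite divr_gt0// ltr0n.
have Nh : N%:R * h = d by rewrite mulrC divfK// pnatr_eq0 -lt0n.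
pose H := smooth (tail G) gamma h N.
have Ganti := @tail_anti _ G.
have Hanti : {homo H : x y /~ x <= y} by exact: smooth_anti.
have GH x : tail G x <= H x by exact: smooth_ge.
have H_gt0 x : 0 < H x by exact: lt_le_trans (GH x).
have H0 x : 0 <= H x by exact: ltW.
have Hratio : H (x - h) / H x @[x --> +oo] --> expR (gamma * h).
  exact: cvg_smooth_ratio.
have [B B0 GB] := both_large_near g0 GL Gm Gcs eps0.
pose A := B + N%:R * h.
have A0 : 0 <= A by rewrite /A Nh addr_ge0// ltW.
have head := near_shift_ratio_le A g0 h0 H_gt0 Hanti Hratio Nfine.
pose k0 := r * (cs - 2 * m + eps).
have VB : \forall x \near +oo,
    ((V \x G) (both_large B x) <= (k0 * tail G x)%:E)%E.
  apply: filterS GB => x GBx.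
  apply: le_trans (both_large_dominated _ r0 B0 VrG) _.
  by rewrite /k0 -mulrA EFinM lee_wpmul2l.
have mid := middle_smooth_le gamma h0 (lexx A) VB.
have eps1 : 0 <= 1 + eps by rewrite addr_ge0// ltW.
have kernel := kernel_integral_le eps1 VmV H0 Hanti head mid.
(* The right-hand side of the hypothesis on [eps], all quantities being finite
   here. *)
pose rho := (1 + eps) * (mV + r * (cs - 2 * m) + (2 + r) * eps).
have re : 0 <= r * (cs - 2 * m) by exact: mulr_ge0.
have re2 : 0 <= r * eps by rewrite mulr_ge0// ltW.
have rho1 : 1 < rho by rewrite /rho; nra.
have kernel_rho : (1 + eps) * mV + k0 <= rho.
  have : 0 <= eps * (r * (cs - 2 * m)) by rewrite mulr_ge0// ltW.
  have : 0 <= eps * (r * eps) by rewrite mulr_ge0// ltW.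
  have : 0 <= eps * eps by rewrite mulr_ge0// ltW.
  rewrite /rho /k0; lra.
pose c := (1 + eps) * expR (gamma * A).
have [x0 [_ x0P]] : \forall x \near +oo,
    (\int[V]_(y in `[0%R, (x - A)%R]) (H (x - y))%:E <= (rho * H x)%:E)%E /\
    tail V (x - A) <= r * c * H x.
  near=> x; split.
    apply: (@le_trans _ _ (((1 + eps) * mV + k0) * H x)%:E); first by near: x.
    by rewrite lee_fin ler_wpM2r.
  have xA : 0 <= x - A.
    by rewrite subr_ge0; near: x; exact: (nbhs_pinfty_ge (num_real A)).
  rewrite (le_trans (VrG _ xA))// -mulrA ler_wpM2l//.
  rewrite (le_trans (GH _))//.
  have : forall y, 0 <= y <= A ->
    H (x - y) <= (1 + eps) * expR (gamma * y) * H x by near: x.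
  by apply; rewrite A0 lexx.
(* The first summand handles [x > x0], the second [x <= x0]. *)
pose C := r * c + (H x0)^-1.
have rc0 : 0 <= r * c by rewrite !mulr_ge0 ?expR_ge0.
have C0 : 0 < C by rewrite ltr_wpDl// invr_gt0.
have step x : 0 <= x -> 1 <= C * H x \/
    (\int[V]_(y in `[0%R, (x - A)%R]) (H (x - y))%:E <= (rho * H x)%:E)%E /\
    tail V (x - A) <= C * H x.
  move=> _; have [xx0|xx0] := ltP x0 x; [right|left].
    have [int tV] := x0P x xx0; split=> //.
    by rewrite (le_trans tV)// ler_wpM2r// lerDl invr_ge0.
  rewrite mulrDl (@le_trans _ _ ((H x0)^-1 * H x))//.
    by rewrite mulrC ler_pdivlMr// mul1r Hanti.
  by rewrite lerDr mulr_ge0.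
have pow := conv_pow_tail_le Vpos H0 Hanti A0 rho1 (ltW C0) step.
have [cd cd0 cdP] := tail_shift_bound G0 Gd.
have rho0 : 0 < rho - 1 by rewrite subr_gt0.
pose K := C / (rho - 1) * (N%:R * cd).
have K0 : 0 < K by rewrite mulr_gt0 ?divr_gt0// mulr_gt0// ltr0n.
exists K; split=> // M _ _ rhoM k x _ x_ge0.
have {}rhoM : rho < M.
  by move: rhoM; rewrite aE -!EFinD -!EFinM lte_fin.
apply: (le_trans (pow k x x_ge0)).
have HG : H x <= N%:R * cd * tail G x.
  rewrite (le_trans (smooth_le _ _ g0 h0 Ganti G0))// Nh -mulrA ler_wpM2l//.
rewrite /K (_ : _ * M ^+ k * _ =
  C / (rho - 1) * M ^+ k * (N%:R * cd * tail G x)); last by ring.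
have Cr0 : 0 <= C / (rho - 1) by rewrite divr_ge0// ltW.
have rhok : 1 <= rho ^+ k by rewrite exprn_ege1// ltW.
have rhoMk : rho ^+ k <= M ^+ k.
  by rewrite lerXn2r ?nnegrE ?(ltW rhoM)//; lra.
apply: ler_pM => //; first by rewrite mulr_ge0// subr_ge0.
by rewrite ler_wpM2l//; lra.
Unshelve. all: by end_near. Qed.
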